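(* Let $r \ge 2$ be a fixed integer. There is a constant $C = C(r)$ such that every $r$-uniform hypergraph $\mathcal{H}$ on $n \ge 2$ vertices which does not contain a tight cycle has at most $C\, n^{r-1} (\log n)^5$ edges. In other words, $\mathrm{ex}_r(n, \mathcal{C}) = O(n^{r-1} (\log n)^5)$.
   Context: An $r$-uniform hypergraph ($r$-graph) has edges that are $r$-element subsets of the vertex set. An $r$-uniform tight cycle of length $\ell$ (with $\ell \ge r+1$) is a sequence $(v_1, \ldots, v_\ell)$ of distinct vertices such that $\{v_i, v_{i+1}, \ldots, v_{i+r-1}\}$ is an edge for every $i \in [\ell]$, with indices taken modulo $\ell$. $\mathrm{ex}_r(n,\mathcal{C})$ denotes the maximum number of edges in an $n$-vertex $r$-graph containing no tight cycle. Logarithms are base $2$. *)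

(* Defs.v *)
From HB Require Import structures.
From mathcomp Require Import all_boot all_order all_algebra.
From mathcomp Require Import all_classical all_reals all_analysis.

Set Implicit Arguments.
Unset Strict Implicit.
Unset Printing Implicit Defensive.

Import Order.TTheory GRing.Theory Num.Theory.
Import numFieldNormedType.Exports.

Local Open Scope ring_scope.

(* A hypergraph on the vertex set T is given by its set of edges. *)
Definition uniform_hypergraph (r : nat) (T : finType) (H : {set {set T}}) : bool :=
  [forall e in H, #|e| == r].

(* For r <= size s, the r first entries of s rotated left i times are the
   entries of s at positions i, i + 1, ..., i + r - 1 modulo size s. *)
Definition tight_cycle (r : nat) (T : finType) (H : {set {set T}}) (s : seq T) : bool :=
  [&& (r.+1 <= size s)%N, uniq s
    & [forall i : 'I_(size s), [set x in take r (rot i s)] \in H]].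

Definition tight_cycle_free (r : nat) (T : finType) (H : {set {set T}}) : Prop :=
  forall s : seq T, ~~ tight_cycle r H s.

Definition ex_tight (r n : nat) : nat :=
  \max_(H : {set {set 'I_n}} |
        uniform_hypergraph r H && `[< tight_cycle_free r H >]) #|H|.

Definition log2 (R : realType) (x : R) : R := ln x / ln 2.

(* Main.v *)
(** Count edges as ordered [r]-tuples and let the shadow be the set of pairs
    (coordinate [i], tuple with [i]-th entry deleted). Among the subfamilies [X]
    whose size is at least [K (p + p log2 p / L)], [p] being the size of the
    shadow, a minimal one has all codegrees at least [K], and superadditivity of
    [p log2 p] makes it an expander: every [F] containing at most 15/16 of [X]
    has at least [|F| / O(L)] tuples outside it that share a facet with it.
    Hence, from any tuple, tight walks with distinct vertices reach 15/16 of [X]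
    within [l = O(L^2)] steps even when [O(l^2)] vertices are forbidden, as long
    as [K] is of order [L l^2 = L^5]: each extension only has to avoid the
    forbidden vertices and those of one walk. Forbidding overloaded vertices, one
    obtains from each [e] walks to 7/8 of [X] such that every vertex lies on few
    of them. For a random triple [e, f, g] the walks [e -> f -> g -> e] exist and
    are pairwise disjoint: in each pair one walk has an endpoint that is
    independent of the other walk. They form a tight cycle. Finally
    [L = O(log2 n)]. *)

Require Import Defs.
From HB Require Import structures.
From mathcomp Require Import all_boot all_order all_algebra.
From mathcomp Require Import zify ring lra.
From mathcomp Require Import boolp reals exp.

Set Implicit Arguments.
Unset Strict Implicit.
Unset Printing Implicit Defensive.

Import Order.TTheory GRing.Theory Num.Theory.

(** * Expanding subfamilies *)

Section Expander.
Local Open Scope ring_scope.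
Context {E S : finType} (inc : E -> {set S}).

Definition shadow (F : {set E}) : {set S} := \bigcup_(x in F) inc x.

Definition boundary (X F : {set E}) : {set E} :=
  [set y in X :\: F | ~~ [disjoint inc y & shadow F]].

Lemma shadowP (F : {set E}) (s : S) :
  reflect (exists2 x, x \in F & s \in inc x) (s \in shadow F).
Proof. exact: bigcupP. Qed.

Lemma shadowS (F G : {set E}) : F \subset G -> shadow F \subset shadow G.
Proof.
move=> /subsetP FG; apply/subsetP => s /shadowP[x xF sx].
by apply/shadowP; exists x => //; exact: FG.
Qed.

(** [g] stands for [p * log2 p]. [X] is inclusion-minimal among the nonempty subfamilies with
    [phi #|shadow X| <= L * #|X|]: a low degree or a small boundary would leave a smaller one. *)
Lemma expander_subset (R : realFieldType) (g : nat -> R) (K L : R)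
    (X0 : {set E}) :
  0 < K -> 1 <= L ->
  g 0%N = 0 -> g 1%N = 0 ->
  (forall x y, (x <= y)%N -> g x + g y + x%:R <= g (x + y)%N) ->
  (forall p, (p <= #|shadow X0|)%N -> g p <= L * p%:R) ->
  X0 != set0 -> 2 * K * #|shadow X0|%:R <= #|X0|%:R ->
  exists X : {set E}, [/\ X \subset X0, X != set0,
    forall s, s \in shadow X -> K <= #|[set x in X | s \in inc x]|%:R
    & forall F : {set E}, F \subset X -> (16 * #|F| <= 15 * #|X|)%N ->
        #|F|%:R <= 16 * (1 + 2 * L) * #|boundary X F|%:R].
Proof.
move=> K0 L1 g0 g1 gD gL X0n dens.
have gmin x y : g x + g y + (minn x y)%:R <= g (x + y)%N.
  case: (leqP x y) => [/gD //|/ltnW /gD]; by rewrite addnC [g y + g x]addrC.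
have gmono : {homo g : x y / (x <= y)%N >-> x <= y}.
  apply: homo_leq => // [x y z|x]; first exact: le_trans.
  have := gmin x 1%N; rewrite g1 addn1; have := ler0n R (minn x 1); lra.
have gge0 p : 0 <= g p by rewrite -g0; apply: gmono.
pose phi p := K * (L * p%:R + g p).
have phimono : {homo phi : x y / (x <= y)%N >-> x <= y}.
  move=> x y xy; rewrite /phi ler_pM2l // lerD ?gmono // ler_wpM2l ?ler_nat //.
  lra.
have phi0 p : 0 <= phi p.
  by rewrite /phi mulr_ge0 ?(ltW K0) // addr_ge0 // mulr_ge0 //; lra.
pose P (X : {set E}) := [&& X != set0, X \subset X0 & phi #|shadow X| <= L * #|X|%:R].
have PX0 : P X0.
  rewrite /P X0n subxx /= /phi.
  apply: (@le_trans _ _ (L * (2 * K * #|shadow X0|%:R))).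
    have := gL _ (leqnn _); set s := _%:R; move=> h.
    rewrite [X in _ <= X](_ : _ = K * (2 * L * s)); last by ring.
    by rewrite ler_pM2l //; lra.
  by rewrite ler_wpM2l //; lra.
have [X /minsetP[/and3P[Xn XX0 Xphi] Xmin] _] := minset_exists PX0.
have sub (F : {set E}) : F \proper X -> F != set0 -> L * #|F|%:R < phi #|shadow F|.
  move=> /andP[FX nXF] Fn; rewrite ltNge; apply/negP => h.
  move: nXF; rewrite (Xmin F) ?subxx // /P Fn h (subset_trans FX XX0) //.
exists X; split => //.
  (* Removing the members through [s] lowers [phi] of the shadow by at least [K * L], while
     minimality gives [L * #|X :\: D| <= phi #|shadow (X :\: D)|]; so at least [K] members were
     removed. *)
  move=> s sX; set D := [set x in X | s \in inc x].
  have DX : D \subset X by apply/subsetP => x; rewrite inE => /andP[].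
  have cD : #|X| = (#|D| + #|X :\: D|)%N.
    by rewrite -(cardsID D X) (setIidPr DX).
  have Dn : (0 < #|D|)%N.
    have /shadowP[x xX sx] := sX; apply/card_gt0P; exists x.
    by rewrite inE xX.
  have sh : (#|shadow (X :\: D)| + 1 <= #|shadow X|)%N.
    rewrite addn1 (cardsD1 s (shadow X)) sX add1n ltnS subset_leq_card //.
    apply/subsetP => t /shadowP[x]; rewrite !inE => /andP[xD xX] tx.
    apply/andP; split; last by apply/shadowP; exists x.
    by apply: contraNneq xD => <-; rewrite xX.
  have h1 : L * #|X :\: D|%:R <= phi #|shadow (X :\: D)|.
    have [->|XDn] := eqVneq (X :\: D) set0.
      by rewrite cards0 mulr0.
    apply/ltW/sub => //; rewrite properE subsetDl /=; apply/negP => h.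
    have := subset_leq_card h.
    by rewrite cD -[X in (_ <= X)%N]add0n leq_add2r leqNgt Dn.
  have h2 := le_trans (phimono _ _ sh) Xphi.
  have h3 : phi #|shadow (X :\: D)| + K * L <= phi (#|shadow (X :\: D)| + 1)%N.
    rewrite /phi natrD; have := gmono _ _ (leq_addr 1%N #|shadow (X :\: D)|).
    rewrite -(ler_pM2l K0); lra.
  have : L * K <= L * #|D|%:R by move: h2; rewrite cD natrD mulrDr; lra.
  by rewrite ler_pM2l //; lra.
move=> F FX FXc; set B := boundary X F; set G := X :\: F :\: B.
have BX : B \subset X :\: F by apply/subsetP => x; rewrite inE => /andP[].
have cX : #|X|%:R = #|F|%:R + #|B|%:R + #|G|%:R :> R.
  rewrite -!natrD -(cardsID F X) (setIidPr FX) -addnA -(cardsID B (X :\: F)).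
  by rewrite (setIidPr BX).
have FXr : 16 * #|F|%:R <= 15 * #|X|%:R :> R by rewrite -!natrM ler_nat.
have X0' : (0 < #|X|)%N by rewrite card_gt0.
have [->|Fn] := eqVneq F set0.
  by rewrite cards0 !mulr_ge0 ?addr_ge0 ?mulr_ge0 // (le_trans ler01 L1).
have [G0|Gn] := eqVneq G set0.
  move: cX FXr; rewrite G0 cards0 -/B.
  move: #|F|%:R #|X|%:R #|B|%:R (ler0n R #|B|) => f x b b0.
  by have : 0 <= L * b; [rewrite mulr_ge0 //; lra | lra].
have Fp : F \proper X.
  rewrite properEcard FX -(ltn_pmul2l (isT : (0 < 16)%N)) (leq_ltn_trans FXc) //.
  by rewrite ltn_pmul2r.
have GX : G \subset X by rewrite (subset_trans (subsetDl _ _)) ?subsetDl.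
have Gp : G \proper X.
  rewrite properEcard GX -(ltr_nat R) cX.
  have : 0 < #|F|%:R :> R by rewrite ltr0n card_gt0.
  by move: #|F|%:R #|G|%:R #|B|%:R (ler0n R #|B|) => f x b; lra.
have hF := sub _ Fp Fn; have hG := sub _ Gp Gn.
have xX : (#|shadow F| <= #|shadow X0|)%N.
  by rewrite subset_leq_card ?shadowS ?(subset_trans FX).
have yX : (#|shadow G| <= #|shadow X0|)%N.
  by rewrite subset_leq_card ?shadowS ?(subset_trans GX).
(* No member of [G] meets the shadow of [F], so the two shadows are disjoint and superadditivity
   applies. *)
have xy : (#|shadow F| + #|shadow G| <= #|shadow X|)%N.
  rewrite -cardsUI.
  have -> : shadow F :&: shadow G = set0.
    apply/setP => s; rewrite !inE; apply/negP => /andP[sF /shadowP[z]].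
    rewrite !inE => /andP[]; case: (z \in F) => //=; case: (z \in X) => //=.
    by rewrite negbK => /disjointFr dz _ /dz; rewrite sF.
  by rewrite cards0 addn0 subset_leq_card // subUset !shadowS.
have hX := le_trans (phimono _ _ xy) Xphi.
have hmin := gmin #|shadow F| #|shadow G|.
rewrite -/B; move: (gL _ xX) (gL _ yX) hX hF hG hmin (ler0n R #|B|) cX FXr.
rewrite /phi natrD.
have : (minn #|shadow F| #|shadow G|)%:R = #|shadow F|%:R :> R \/
       (minn #|shadow F| #|shadow G|)%:R = #|shadow G|%:R :> R.
  by rewrite /minn; case: ifP => _; [left|right].
move: (minn _ _)%:R (g #|shadow F|) (g #|shadow G|) (g (#|shadow F| + _)%N).
move: #|shadow F|%:R #|shadow G|%:R #|F|%:R #|G|%:R #|B|%:R #|X|%:R.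
clear -K0 L1 => x y f h b c m gx gy gxy hm hx hy hX hF hG hmin b0 cX FX.
have L0 : 0 < L by lra.
have Kx : K * gx <= K * (L * x) by rewrite ler_pM2l.
have Ky : K * gy <= K * (L * y) by rewrite ler_pM2l.
have Km : K * (gx + gy + m) <= K * gxy by rewrite ler_pM2l.
have e1 : L * c = L * f + L * b + L * h by rewrite cX; ring.
(* Neither [F] nor [G] is dense, so the surplus [K * m] of superadditivity is paid by the
   boundary. *)
have hb : K * m <= L * b by lra.
have hfx : f <= 2 * (K * x) by rewrite -(ler_pM2l L0); lra.
have hgy : h <= 2 * (K * y) by rewrite -(ler_pM2l L0); lra.
have Lb : 0 <= L * b by apply: mulr_ge0 => //; exact: ltW.
(* If [m] is [x], then [f <= 2 * L * b]. If [m] is [y], then [h <= 2 * L * b], and the factor 16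
   arises because [F] misses at least 1/16 of [X]. *)
by case: hm hb => -> hb; lra.
Qed.

End Expander.

(** * Arithmetic of one round of growth *)

Section GrowthArithmetic.
Local Open Scope ring_scope.

(** Going back from index [r], each step costs a factor [1 - eta], and [(1 - eta) * (1 - k * eta) >=
    1 - k.+1 * eta]. *)
Lemma decreasing_chain (R : realFieldType) (r : nat) (eta : R) (u b : nat -> R) :
  0 <= eta -> r%:R * eta <= 1 ->
  (forall j, 0 <= b j <= u j) ->
  (forall j, (j < r)%N -> u j * (1 - eta) <= b j.+1) ->
  forall j, (j < r)%N -> (1 - r%:R * eta) * u j <= b r.
Proof.
move=> eta0 reta bu ub j jr.
have u0 k : 0 <= u k by have /andP[] := bu k; exact: le_trans.
suff h k : (k < r)%N -> (1 - k.+1%:R * eta) * u (r - k.+1)%N <= b r.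
  have := h (r - j.+1)%N; rewrite ltn_subrL (leq_trans _ jr) //.
  rewrite -subSn // subSS subKn; last exact: ltnW.
  move=> /(_ isT); apply: le_trans; rewrite ler_wpM2r // lerD2l lerN2.
  by rewrite ler_wpM2r // ler_nat leq_subr.
elim: k => [r0|k IH kr].
  by have := ub (r - 1)%N; rewrite subn1 prednK // mul1r mulrC => ->.
have h1 := IH (ltnW kr).
have := ub (r - k.+2)%N; rewrite -subSn // subSS => /(_ (leq_subr _ _)) h2.
have h3 := le_trans h2 (proj2 (andP (bu _))).
have ke : 0 <= 1 - k.+1%:R * eta.
  by rewrite subr_ge0 (le_trans _ reta) // ler_wpM2r // ler_nat ltnW.
apply: le_trans h1; apply: le_trans (ler_wpM2l ke h3).
rewrite -[k.+2%:R]natr1 [leRHS]mulrCA [leRHS]mulrC ler_wpM2r //.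
have : 0 <= k.+1%:R * eta * eta by rewrite !mulr_ge0.
by move: k.+1%:R {IH kr h2 h3 ke}; clear; move=> y h; lra.
Qed.

(** Without errors, [x <= A * (m - x)] would give growth by the factor [1 + 1/A]; errors of relative
    size [1/(16 * A)] leave at least half of that gain. *)
Lemma growth_arith (R : realFieldType) (A x b c m : R) :
  1 <= A -> 0 <= m -> c = (1 - (16 * A)^-1) * m ->
  b - (16 * A)^-1 * m <= x -> x <= A * (m - x) ->
  (2 * A + 1) * b <= 2 * A * c.
Proof.
move=> A1 m0 -> hb hx.
have A0 : 0 < A by lra.
have A10 : 0 < 1 + A by lra.
have iA : A * (16 * A)^-1 = 16^-1 by field; lra.
have i0 : 0 < (16 * A)^-1 by rewrite invr_gt0; lra.
have i1 : (16 * A)^-1 <= 16^-1 by rewrite lef_pV2 ?posrE; lra.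
move: (16 * A)^-1 hb iA i0 i1 => i hb iA i0 i1.
have h2 : b * (1 + A) <= (A + i * (1 + A)) * m.
  have : b * (1 + A) <= (x + i * m) * (1 + A) by rewrite ler_pM2r //; lra.
  by lra.
have h3 : (2 * A + 1) * (A + i * (1 + A)) <= 2 * A * (1 - i) * (1 + A).
  have e2 : (2 * A + 1) * (A + i * (1 + A)) =
    2 * A ^+ 2 + A + 2 * (A * i) + 2 * (A * i) * A + i + A * i by ring.
  have e3 : 2 * A * (1 - i) * (1 + A) =
    2 * A ^+ 2 + 2 * A - 2 * (A * i) - 2 * (A * i) * A by ring.
  by rewrite e2 e3 iA; lra.
rewrite -(ler_pM2r A10).
apply: le_trans (_ : (2 * A + 1) * ((A + i * (1 + A)) * m) <= _).
  by rewrite -mulrA ler_pM2l //; lra.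
have := ler_wpM2r m0 h3; lra.
Qed.

End GrowthArithmetic.

Lemma card_bigcup_leq (I E : finType) (A : {pred I}) (F : I -> {set E}) :
  (#|\bigcup_(i in A) F i| <= \sum_(i in A) #|F i|)%N.
Proof.
elim/big_rec2: _ => [|i s n _ IH]; first by rewrite cards0.
by rewrite (leq_trans (leq_card_setU _ _)) ?leq_add2l.
Qed.

(** * Growth under exchange of one coordinate after another *)

Section Growth.
Local Open Scope ring_scope.
Context {E S : finType} (X : {set E}).

Definition star (f : E -> S) (B : {set E}) : {set E} :=
  [set y in X | f y \in f @: B].

Lemma sub_star (f : E -> S) (B : {set E}) : B \subset X -> B \subset star f B.
Proof.
move=> BX; apply/subsetP => x xB; rewrite inE (subsetP BX) //=.
exact: imset_f.
Qed.

Lemma starS (f : E -> S) (A B : {set E}) :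
  A \subset B -> star f A \subset star f B.
Proof.
move=> AB; apply/subsetP => x; rewrite !inE => /andP[-> /=].
exact/subsetP/imsetS.
Qed.

(** Split [star f B] into fibres of [f]: each has at least [K] members, at most [q] of them outside
    [B']. *)
Lemma card_star_missed (f : E -> S) (B B' : {set E}) (K q : nat) :
  B \subset X ->
  (forall x, x \in B -> K <= #|[set y in X | f y == f x]|)%N ->
  (forall x, x \in B -> #|[set y in X | f y == f x] :\: B'| <= q)%N ->
  (K * #|star f B :\: B'| <= q * #|star f B|)%N.
Proof.
move=> BX deg miss.
have cardE (A : {set E}) : A \subset star f B ->
    #|A| = (\sum_(s in f @: B) #|[set y in A | f y == s]|)%N.
  move=> AU; rewrite -sum1_card (partition_big f (mem (f @: B))) /=.
    by apply: eq_bigr => s _; rewrite sum1dep_card; apply: eq_card => y; rewrite inE.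
  by move=> y /(subsetP AU); rewrite inE => /andP[].
rewrite (cardE _ (subsetDl _ B')) (cardE _ (subxx _)) !big_distrr /=.
apply: leq_sum => _ /imsetP[x xB ->]; rewrite mulnC; apply: leq_mul.
  apply: leq_trans (miss _ xB); apply/subset_leq_card/subsetP => y.
  by rewrite !inE => /andP[/and3P[-> -> _] ->].
apply: leq_trans (deg _ xB) _; apply/subset_leq_card/subsetP => y.
by rewrite !inE => /andP[-> /eqP ->]; rewrite eqxx imset_f.
Qed.

(* If a round gains too little, the sets [B 0, .., B r] nearly coincide, and
   the boundary of their intersection contradicts the expansion of [X]. *)
Lemma round_growth (R : realFieldType) (r M : nat) (f : nat -> E -> S) (B : nat -> {set E}) :
  (0 < r)%N -> (0 < M)%N ->
  (forall j, B j \subset X) ->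
  (forall j, j < r ->
     16 * r ^ 2 * M * #|star (f j) (B j) :\: B j.+1| <= #|star (f j) (B j)|)%N ->
  (forall F : {set E}, F \subset X -> 16 * #|F| <= 15 * #|X| ->
     #|F| <= M * #|\bigcup_(j < r) star (f j) F :\: F|)%N ->
  (16 * #|B 0| <= 15 * #|X|)%N ->
  ((2 * (r * M)).+1 * #|B 0| <= 2 * (r * M) * #|B r|)%N.
Proof.
move=> r0 M0 BX step expX B0X.
pose U j := star (f j) (B j).
pose F := fix F k := if k is k'.+1 then F k' :&: B k else B 0.
have FB k : F k \subset B k by case: k => [|k] //=; exact: subsetIr.
have FBj j k : (j <= k)%N -> F k \subset B j.
  elim: k => [|k IH]; first by rewrite leqn0 => /eqP ->.
  rewrite leq_eqVlt => /predU1P[->|]; first exact: FB.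
  by rewrite ltnS => /IH; apply: subset_trans; exact: subsetIl.
have [A AE A1] : exists2 A : R, A = (r * M)%:R & 1 <= A.
  by exists (r * M)%:R => //; rewrite ler1n muln_gt0 r0.
have A0 : 0 < 16 * A by rewrite mulr_gt0 ?ltr0n ?(lt_le_trans ltr01).
have rr0 : 0 < r%:R :> R by rewrite ltr0n.
(* [eta] is the inverse of [16 * r ^ 2 * M] and bounds the proportion missed in one step; over [r]
   steps this adds up to [1 / (16 * A)]. *)
have [eta etaE] : exists eta : R, eta = (16 * A * r%:R)^-1 by eexists.
have eta0 : 0 < eta by rewrite etaE invr_gt0 mulr_gt0.
have reta : r%:R * eta = (16 * A)^-1.
  by rewrite etaE invfM mulrC mulfVK // gt_eqF.
have reta1 : r%:R * eta < 1.
  rewrite reta invf_lt1 // (lt_le_trans (_ : 1 < 16)) ?ltr1n //.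
  by rewrite ler_peMr.
pose u j : R := #|U j|%:R; pose b j : R := #|B j|%:R.
have stepr j : (j < r)%N -> #|U j :\: B j.+1|%:R <= eta * u j.
  move=> jr; rewrite etaE mulrC ler_pdivlMr ?(mulr_gt0 A0 rr0) //.
  rewrite AE -!natrM ler_nat; apply: leq_trans (step _ jr).
  by apply: eq_leq; ring.
have bu j : 0 <= b j <= u j by rewrite ler0n ler_nat subset_leq_card ?sub_star.
have ub j : (j < r)%N -> u j * (1 - eta) <= b j.+1.
  move=> jr; rewrite mulrBr mulr1 lerBlDr mulrC.
  apply: le_trans (lerD (lexx _) (stepr _ jr)); rewrite -natrD ler_nat.
  by rewrite -(cardsID (B j.+1) (U j)) leq_add2r subset_leq_card ?subsetIr.
have ur := decreasing_chain (ltW eta0) (ltW reta1) bu ub.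
have c0 : 0 < 1 - r%:R * eta by rewrite subr_gt0.
(* By the chain inequality, [m] bounds the sizes of all [U j] with [j < r] at once. *)
pose m := b r / (1 - r%:R * eta).
have um j : (j < r)%N -> u j <= m by move=> /ur; rewrite /m ler_pdivlMr // mulrC.
have m0 : 0 <= m by rewrite divr_ge0 // ltW.
(* Intersecting with [B k.+1] loses only members of [U k :\: B k.+1], at most [eta * m] of them. *)
have Flow k : (k <= r)%N -> b 0%N <= #|F k|%:R + k%:R * (eta * m).
  elim: k => [_|k IH kr]; first by rewrite mul0r addr0.
  apply: le_trans (IH (ltnW kr)) _.
  rewrite -(cardsID (B k.+1) (F k)) natrD -natr1 mulrDl mul1r [_ + eta * m]addrC.
  rewrite addrA lerD2r lerD2l; apply: le_trans (ler_wpM2l (ltW eta0) (um _ kr)).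
  apply: le_trans (stepr _ kr).
  by rewrite ler_nat subset_leq_card // setSD // (subset_trans (FB _)) ?sub_star.
have FX : F r \subset X := subset_trans (FB r) (BX r).
have F0 : (#|F r| <= #|B 0|)%N by rewrite subset_leq_card ?FBj.
have Fexp := expX _ FX (leq_trans (leq_mul (leqnn _) F0) B0X).
(* The star of [F r] along [f j] lies in [U j], which contains [F r] and has at most [m] members. *)
have bdF : #|\bigcup_(j < r) star (f j) (F r) :\: F r|%:R <= r%:R * (m - #|F r|%:R).
  have : (#|\bigcup_(j < r) star (f j) (F r) :\: F r| <=
          \sum_(j < r) #|U j :\: F r|)%N.
    have -> : \bigcup_(j < r) star (f j) (F r) :\: F r =
              \bigcup_(j < r) (star (f j) (F r) :\: F r).
      apply/setP => y; rewrite !inE; apply/andP/bigcupP.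
        by move=> [yF /bigcupP[j _ yj]]; exists j => //; rewrite inE yF.
      by move=> [j _]; rewrite inE => /andP[yF yj]; split=> //; apply/bigcupP; exists j.
    apply: leq_trans (card_bigcup_leq _ _) _; apply: leq_sum => j _.
    by apply/subset_leq_card/setSD/starS/FBj/ltnW.
  rewrite -(ler_nat R) => /le_trans; apply.
  rewrite natr_sum mulr_natl -[X in _ *+ X]card_ord -sumr_const.
  apply: ler_sum => j _; rewrite lerBrDr -natrD.
  have FU : F r \subset U j.
    by rewrite (subset_trans (FBj j r _)) ?sub_star // ltnW.
  by rewrite -{2}(setIidPr FU) addnC cardsID um.
rewrite -(ler_nat R) [leLHS]natrM [leRHS]natrM -natr1 !(natrM _ 2) -AE -/(b _) -/(b r).
apply: (@growth_arith _ _ #|F r|%:R _ _ m) => //.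
- by rewrite /m -reta mulrC divfK // gt_eqF.
- by rewrite lerBlDr -reta -mulrA Flow.
apply: le_trans (_ : M%:R * (r%:R * (m - #|F r|%:R)) <= _).
  by apply: le_trans (ler_wpM2l (ler0n _ _) bdF); rewrite -natrM ler_nat.
by rewrite mulrA -natrM mulnC AE.
Qed.

End Growth.

(** * Tight walks *)

Section TightWalks.
Context {T : finType} (H : {set {set T}}).

Definition windows_in (r : nat) (s : seq T) : Prop :=
  forall k, k + r <= size s -> [set z in take r (drop k s)] \in H.

(** The overlap [f] has length at least [r - 1], so a window that starts in [a] ends before [b]. *)
Lemma windows_in_cat (r : nat) (a f b : seq T) :
  r <= (size f).+1 -> windows_in r (a ++ f) -> windows_in r (f ++ b) ->
  windows_in r (a ++ f ++ b).
Proof.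
move=> rf wa wb k; rewrite !size_cat => kr.
have [ka|ka] := leqP (size a) k.
  rewrite drop_cat ltnNge ka /=; apply: wb.
  by rewrite size_cat -(leq_add2l (size a)) addnA subnKC.
have kaf : k + r <= size (a ++ f).
  by rewrite size_cat (leq_trans (leq_add (leqnn k) rf)) // addnS -addSn leq_add2r.
rewrite catA drop_cat size_cat ltn_addr // takel_cat ?wa //.
by rewrite size_drop -(leq_add2l k) subnKC // (leq_trans (leq_addr r k)).
Qed.

(** A window of [c] that wraps around starts in the final [e]; the same window occurs in [e ++ c],
    starting in the initial copy of [e]. *)
Lemma tight_cycle_of_windows (r : nat) (e c : seq T) :
  uniq c -> r < size c -> size e = r -> windows_in r (e ++ c) ->
  (exists p, c = p ++ e) -> tight_cycle r H c.
Proof.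
move=> uc rc er w [p cE]; rewrite /tight_cycle uc rc /=.
apply/forallP => -[i ic] /=.
have [h|h] := leqP (i + r) (size c).
  rewrite /rot takel_cat; last by rewrite size_drop leq_subRL // ltnW.
  have := w (size e + i); rewrite size_cat -addnA leq_add2l => /(_ h).
  by rewrite drop_cat ltnNge leq_addr /= addKn.
have pi : size p < i.
  by move: h; rewrite cE size_cat er ltn_add2r.
pose k := i - size p.
have iE : i = size p + k by rewrite /k subnKC // ltnW.
have kr : k < r by move: ic; rewrite iE cE size_cat er ltn_add2l.
have dE : drop i c = drop k e.
  by rewrite iE cE drop_cat ltnNge leq_addr /= addKn.
have := w k; rewrite size_cat er addnC leq_add2l.
rewrite (leq_trans (ltnW kr) (ltnW rc)) => /(_ isT).
rewrite drop_cat er kr /rot dE !take_cat size_drop er ltnNge leq_subr /=.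
by rewrite subKn ?(ltnW kr) // take_takel // iE leq_addl.
Qed.

Section Tuples.
Context {m : nat}.
Implicit Types (x y e : m.+1.-tuple T) (X : {set m.+1.-tuple T}).

Definition turn x : m.+1.-tuple T := [tuple of rot 1 x].

(* After [t] steps of a walk, the last [m.+1] vertices read [iter t turn x],
   where coordinate [t %% m.+1] of [x] is the oldest vertex; [facet t x] drops
   it. *)
Definition facet (t : nat) x : m.-tuple T := [tuple of behead (iter t turn x)].

Lemma turn_inj : injective turn.
Proof. by move=> x y /(congr1 val) /= /rot_inj /val_inj. Qed.

Lemma iter_turn_inj t : injective (iter t turn).
Proof. by elim: t => [|t IH] x y //= /turn_inj /IH. Qed.

Lemma iter_turn_period k x : iter (k * m.+1) turn x = x.
Proof.
have h t : t <= m.+1 -> iter t turn x = rot t x :> seq T.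
  elim: t => [|t IH] tm; first by rewrite rot0.
  by rewrite rotS ?size_tuple // -IH ?(ltnW tm).
elim: k => // k IH; rewrite mulSn iterD IH.
by apply: val_inj; rewrite /= (h m.+1 (leqnn _)) rot_oversize ?size_tuple.
Qed.

Lemma facet_period k j x : facet (k * m.+1 + j) x = facet j x.
Proof. by apply: val_inj; rewrite /= addnC iterD iter_turn_period. Qed.

Lemma mem_iter_turn t x : iter t turn x =i x.
Proof. by elim: t => // t IH z; rewrite /= mem_rot IH. Qed.

Lemma iter_turn_facet t x :
  iter t turn x = thead (iter t turn x) :: facet t x :> seq T.
Proof. by rewrite /=; case/tupleP: (iter t turn x) => a z; rewrite theadE. Qed.

Lemma facet_thead_inj t x y :
  facet t x = facet t y -> thead (iter t turn x) = thead (iter t turn y) -> x = y.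
Proof.
move=> fE hE; apply/(@iter_turn_inj t)/val_inj.
by rewrite /= !iter_turn_facet fE hE.
Qed.

(** [W] restricts only the vertices [s] appended to [e]; the starting tuple may meet [W]. *)
Definition tight_walk e (W : {set T}) (t : nat) x (s : seq T) : Prop :=
  [/\ size s = t, uniq (e ++ s), {in s, forall u, u \notin W},
      windows_in m.+1 (e ++ s) & exists p, e ++ s = p ++ iter t turn x].

(** The only new window is the common facet followed by the new vertex; as a set it is [y]. *)
Lemma tight_walk_extend e W t x y s :
  tight_walk e W t x s -> facet t y = facet t x -> [set z in y] \in H ->
  thead (iter t turn y) \notin W -> thead (iter t turn y) \notin e ++ s ->
  tight_walk e W t.+1 y (rcons s (thead (iter t turn y))).
Proof.
move=> [st us sW ws [p sE]] fE yH; have yE := iter_turn_facet t y.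
set v := thead _ in yE * => vW vs.
have catE : e ++ rcons s v = rcons p (thead (iter t turn x)) ++ facet t x ++ [:: v].
  by rewrite -rcons_cat sE iter_turn_facet -!cats1 -!catA.
split.
- by rewrite size_rcons st.
- by rewrite -rcons_cat rcons_uniq vs.
- by move=> u; rewrite mem_rcons inE => /predU1P[-> //|/sW].
- rewrite catE; apply: windows_in_cat; first by rewrite size_tuple.
    by rewrite cat_rcons -iter_turn_facet -sE.
  move=> k; rewrite size_cat size_tuple addn1 -[X in _ <= X]add0n leq_add2r leqn0.
  move=> /eqP ->; rewrite drop0 take_oversize ?size_cat ?size_tuple ?addn1 //.
  rewrite cats1 (_ : [set z in _] = [set z in y]) //.
  by apply/setP => z; rewrite !inE mem_rcons -fE -yE mem_iter_turn.
exists (rcons p (thead (iter t turn x))).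
have -> : iter t.+1 turn y = rcons (facet t y) v :> seq T.
  by rewrite iterS [LHS](_ : _ = rot 1 (iter t turn y)) // yE rot1_cons.
by rewrite catE fE cats1.
Qed.

Definition reached X e W t : {set m.+1.-tuple T} :=
  [set x in X | `[< exists s, tight_walk e W t x s >]].

Lemma reachedP X e W t x :
  reflect (x \in X /\ exists s, tight_walk e W t x s) (x \in reached X e W t).
Proof.
rewrite inE; apply: (iffP andP) => [[-> /asboolP]|[-> ?]] //.
by split=> //; apply/asboolP.
Qed.

(** A tuple on the facet of [x] is determined by its new vertex, and it can be missed only if this
    vertex lies in [W] or among the [m.+1 + t] vertices of the walk to [x]. *)
Lemma card_facet_missed X e W t x :
  (forall y, y \in X -> [set z in y] \in H) -> x \in reached X e W t ->
  #|[set y in X | facet t y == facet t x] :\: reached X e W t.+1| <=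
    #|W| + m.+1 + t.
Proof.
move=> XH /reachedP[xX [s ws]].
set D := _ :\: _; rewrite -(card_in_imset (f := fun y => thead (iter t turn y)) (D := D)).
  have : [set thead (iter t turn y) | y in D] \subset W :|: [set z in e ++ s].
    apply/subsetP => u /imsetP[y /setDP[]]; rewrite inE => /andP[yX /eqP yx] yR {u}->.
    rewrite !inE in yR *.
    rewrite -[_ || _]negbK negb_or; apply: contra yR => /andP[vW vs].
    rewrite yX; apply/asboolP; eexists.
    by apply: (tight_walk_extend ws) => //; exact: XH.
  move=> /subset_leq_card/leq_trans; apply.
  apply: leq_trans (leq_card_setU _ _) _; rewrite -addnA leq_add2l cardsE.
  by apply: leq_trans (card_size _) _; case: ws => st _ _ _ _; rewrite size_cat size_tuple st.
move=> y z /setDP[+ _] /setDP[+ _].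
rewrite !inE => /andP[_ /eqP yx] /andP[_ /eqP zx].
by apply: facet_thead_inj; rewrite yx zx.
Qed.

Lemma tight_walk0 X e W : e \in X -> uniq e -> [set z in e] \in H ->
  e \in reached X e W 0.
Proof.
move=> eX ue eH; apply/reachedP; split=> //; exists [::]; split=> //; last by exists [::]; rewrite cats0.
  by rewrite cats0.
move=> k; rewrite cats0 size_tuple -[X in _ <= X]add0n leq_add2r leqn0.
by move=> /eqP ->; rewrite drop0 take_oversize ?size_tuple.
Qed.

End Tuples.
End TightWalks.

(** * Reaching most of an expander *)

Lemma expn_succ_ge (A k : nat) : A ^ k * (A + k) <= A.+1 ^ k * A.
Proof.
elim: k => [|k IH]; first by rewrite addn0.
have := leq_mul (leqnn A.+1) IH; rewrite !expnS !mulnA; apply: leq_trans.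
by move: (A ^ k) => a; nia.
Qed.

(** Bernoulli's inequality: [A] rounds with growth factor [1 + 1/A] double a set. *)
Lemma expn_succ_double (A : nat) : 0 < A -> 2 * A ^ A <= A.+1 ^ A.
Proof.
by move=> A0; rewrite -(leq_pmul2r A0) (leq_trans _ (expn_succ_ge A A)) //; nia.
Qed.

(** With [A = 2 * (m.+1 * M)], these are [A * L] rounds of [m.+1] steps: [A] rounds per doubling and
    [L] doublings. *)
Definition walk_length (m M L : nat) : nat := m.+1 * (2 * (m.+1 * M) * L).

Section Reach.
Context {T : finType} (H : {set {set T}}) {m : nat}.
Context (X : {set m.+1.-tuple T}) (K M L : nat).
Implicit Types (e x y : m.+1.-tuple T) (W : {set T}).

Definition robust_expander : Prop :=
  [/\ forall x, x \in X -> uniq x /\ [set z in x] \in H,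
      forall t x, x \in X -> K <= #|[set y in X | facet t y == facet t x]|
    & forall F : {set m.+1.-tuple T}, F \subset X -> 16 * #|F| <= 15 * #|X| ->
        #|F| <= M * #|\bigcup_(j < m.+1) star X (facet j) F :\: F| ].

(** If every round ended with at most 15/16 of [X], each would enlarge the reached set by the factor
    [1 + 1/A], and after [A * L] rounds it would exceed [#|X|]. The bound on [K] makes the
    extensions missed on a facet negligible. *)
Lemma reached_most e W : 0 < M -> #|X| < 2 ^ L -> robust_expander ->
  16 * m.+1 ^ 2 * M * (#|W| + m.+1 + walk_length m M L) <= K -> e \in X ->
  exists2 k, k * m.+1 <= walk_length m M L
    & 15 * #|X| < 16 * #|reached H X e W (k * m.+1)|.
Proof.
move=> M0 XL [XH deg expX] big eX; set q := #|W| + _ + _ in big.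
set A := 2 * (m.+1 * M); have A0 : 0 < A by rewrite !muln_gt0.
apply: contrapT => none.
have small k : k <= A * L -> 16 * #|reached H X e W (k * m.+1)| <= 15 * #|X|.
  move=> kA; rewrite leqNgt; apply/negP => lt; apply: none; exists k => //.
  by rewrite mulnC leq_mul2l kA.
have grow k : k < A * L ->
    A.+1 * #|reached H X e W (k * m.+1)| <= A * #|reached H X e W (k.+1 * m.+1)|.
  move=> kA; rewrite [k.+1 * _]mulSnr; pose B j := reached H X e W (k * m.+1 + j).
  have := @round_growth _ _ X rat m.+1 M facet B; rewrite /B addn0; apply => //.
  - by move=> j; apply/subsetP => x /reachedP[].
  - move=> j jm; have q0 : 0 < q by rewrite /q addnAC addnS.
    rewrite -(leq_pmul2l q0) addnS.
    set B0 := reached H X e W (_ + j); set B1 := reached _ _ _ _ _.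
    apply: leq_trans (_ : K * #|star X (facet j) B0 :\: B1| <= _).
      by rewrite mulnA leq_mul2r mulnC big orbT.
    have B0X : B0 \subset X by apply/subsetP => x /reachedP[].
    apply: card_star_missed => // x xB; first by apply: deg; exact: (subsetP B0X).
    have := card_facet_missed (fun y yX => proj2 (XH y yX)) xB.
    have -> : [set y in X | facet j y == facet j x] =
        [set y in X | facet (k * m.+1 + j) y == facet (k * m.+1 + j) x].
      by apply/setP => y; rewrite !inE !facet_period.
    move=> /leq_trans; apply; rewrite leq_add2l.
    apply: leq_trans (_ : k.+1 * m.+1 <= _).
      by rewrite mulSnr leq_add2l ltnW.
    by rewrite mulnC leq_mul2l kA orbT.
  - by apply: small; exact: ltnW.
have pow k : k <= A * L -> A.+1 ^ k <= A ^ k * #|reached H X e W (k * m.+1)|.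
  elim: k => [_|k IH kA].
    rewrite !expn0 mul1n card_gt0; apply/set0Pn; exists e.
    by have [ue eH] := XH _ eX; exact: tight_walk0.
  rewrite !expnS; apply: leq_trans (leq_mul (leqnn _) (IH (ltnW kA))) _.
  by rewrite mulnCA [A * A ^ k]mulnC -mulnA leq_mul2l grow ?orbT.
have := pow _ (leqnn _); rewrite leqNgt => /negP; apply.
apply: leq_ltn_trans (_ : A ^ (A * L) * #|X| < _).
  by rewrite leq_mul2l subset_leq_card ?orbT //; apply/subsetP => x /reachedP[].
apply: leq_trans (_ : A ^ (A * L) * 2 ^ L <= _).
  by rewrite ltn_pmul2l ?expn_gt0 ?A0.
rewrite !(expnM _ A L) -expnMn; case: (posnP L) => [->|L0] //.
by rewrite leq_exp2r // mulnC expn_succ_double.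
Qed.

End Reach.

(** * Walks of low congestion *)

Section Congestion.
Context {E T : finType} (X : {set E}).

Definition load (D : {set E}) (p : E -> seq T) (u : T) : nat :=
  #|[set x in D | u \in p x]|.

Lemma card_setI_sum (P : pred E) : #|[set x in X | P x]| = \sum_(x in X) P x.
Proof.
rewrite -sum1_card (eq_bigl (fun x => (x \in X) && P x)).
  by rewrite big_mkcondr; apply: eq_bigr => x _; case: (P x).
by move=> x; rewrite inE.
Qed.

(* Vertices that are already used by many of the chosen sequences are
   forbidden to the next one; there are few of them, by double counting. *)
Lemma low_congestion (good : E -> seq T -> Prop) (l : nat) :
  0 < l -> 16 * l <= #|X| ->
  (forall x s, good x s -> size s <= l) ->
  (forall W : {set T}, #|W| <= 16 * l ^ 2 ->
     exists A : {set E}, [/\ A \subset X, 15 * #|X| < 16 * #|A| &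
       forall x, x \in A -> exists2 s, good x s & {in s, forall u, u \notin W}]) ->
  exists (D : {set E}) (p : E -> seq T),
    [/\ D \subset X, 8 * #|X :\: D| <= #|X|, forall x, x \in D -> good x (p x)
      & forall u, 8 * l * load D p u <= #|X|].
Proof.
move=> l0 Xl size_good avoid.
have X0 : 0 < #|X| by rewrite (leq_trans _ Xl) // muln_gt0.
(* The load may pass the cutoff [#|X| / (16 * l)] by one; since [16 * l <= #|X|], this still gives
   the bound wanted. For [n = #|X|.+1] only the second alternative can hold. *)
suff greedy n : exists (D : {set E}) (p : E -> seq T),
    [/\ D \subset X, forall x, x \in D -> good x (p x),
      forall u, 16 * l * load D p u <= #|X| + 16 * l
      & (n <= #|D|) || (8 * #|X :\: D| <= #|X|)].
  have [D [p [DX Dgood Dload]]] := greedy #|X|.+1.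
  rewrite leqNgt ltnS subset_leq_card //= => DXc.
  exists D, p; split=> // u; have := leq_trans (Dload u) (leq_add (leqnn _) Xl).
  by rewrite addnn -mul2n -[16]/(2 * 8) -!mulnA leq_pmul2l.
elim: n => [|n [D [p [DX Dgood Dload]]]].
  exists set0, (fun=> [::]); split; rewrite ?sub0set //.
    by move=> x; rewrite inE.
  move=> u; rewrite /load (_ : [set x in _ | _] = set0) ?cards0 ?muln0 //.
  by apply/setP => x; rewrite !inE.
case/orP => [Dn|Dc]; last by exists D, p; rewrite Dc orbT.
have [Dc|Dc] := leqP (8 * #|X :\: D|) #|X|; first by exists D, p; rewrite Dc orbT.
pose W := [set u | #|X| < 16 * l * load D p u].
(* The loads sum to at most [l * #|X|], and each vertex of [W] carries more than
   [#|X| / (16 * l)]. *)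
have Wc : #|W| <= 16 * l ^ 2.
  rewrite -(leq_pmul2r X0) -sum_nat_const.
  apply: leq_trans (_ : \sum_(u in W) 16 * l * load D p u <= _).
    by apply: leq_sum => u; rewrite inE => /ltnW.
  rewrite -big_distrr /= -mulnn -!mulnA !leq_pmul2l //.
  apply: leq_trans (_ : \sum_(u : T) load D p u <= _).
    by rewrite [X in _ <= X](bigID (mem W)) leq_addr.
  apply: leq_trans (_ : \sum_(x in D) l <= _); last first.
    by rewrite sum_nat_const mulnC leq_pmul2l // subset_leq_card.
  under eq_bigr do rewrite /load -sum1_card.
  under eq_bigr => u _.
    rewrite (eq_bigl (fun x => (x \in D) && (u \in p x))); last first.
      by move=> x; rewrite inE.
    over.
  rewrite (exchange_big_dep (mem D)) /=; last by move=> u x _ /andP[].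
  apply: leq_sum => x xD; rewrite (eq_bigl (mem (p x))) ?sum1_card.
    exact: leq_trans (card_size _) (size_good _ _ (Dgood _ xD)).
  by move=> u; rewrite xD.
have [A [AX Ac Agood]] := avoid W Wc.
(* [A] misses less than 1/16 of [X], whereas [D] misses more than 1/8. *)
have /subsetPn[x xA xD] : ~~ (A \subset D).
  apply/negP => AD.
  have : #|A| <= #|D| by exact: subset_leq_card.
  have := cardsID D X; rewrite (setIidPr DX).
  by move: Dc Ac; move: #|_ :\: _| #|D| #|A| #|X|; clear; lia.
have [s sgood sW] := Agood _ xA.
exists (x |: D), (fun y => if y == x then s else p y); split.
- by rewrite subUset sub1set (subsetP AX).
- move=> y; rewrite in_setU1; case: (eqVneq y x) => [->|_ /=] //; exact: Dgood.
- move=> u; rewrite /load.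
  set D' := [set y in _ | _].
  have D'sub : D' \subset [set y in D | u \in p y] :|: [set y | (y == x) && (u \in s)].
    apply/subsetP => y; rewrite !inE.
    by case: (eqVneq y x) => [-> /= ->|_ /= ->] //; rewrite orbT.
  have := leq_trans (subset_leq_card D'sub) (leq_card_setU _ _).
  have [us|us] := boolP (u \in s); last first.
    rewrite (_ : [set y | (y == x) && false] = set0) ?cards0 ?addn0.
      by move=> h; apply: leq_trans (Dload u); rewrite leq_mul2l h orbT.
    by apply/setP => y; rewrite !inE andbF.
  rewrite (_ : [set y | (y == x) && true] = [set x]) ?cards1; last first.
    by apply/setP => y; rewrite !inE andbT.
  have := sW _ us; rewrite inE -leqNgt => uW h.
  rewrite (leq_trans (leq_mul (leqnn _) h)) // mulnDr muln1 leq_add2r //.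
by rewrite cardsU1 xD add1n ltnS Dn.
Qed.

(* Union bound over the six bad events, each of density at most 1/8. *)
Lemma good_triple (b : rel E) (h : E -> E -> E -> bool) :
  X != set0 ->
  (forall e, e \in X -> 8 * #|[set f in X | b e f]| <= #|X|) ->
  (forall e f, e \in X -> f \in X -> 8 * #|[set g in X | h e f g]| <= #|X|) ->
  exists e f g, [/\ e \in X, f \in X & g \in X] /\
    [&& ~~ b e f, ~~ b f g, ~~ b g e, ~~ h e f g, ~~ h f g e & ~~ h g e f].
Proof.
rewrite -card_gt0 => X0 hb hh; apply: contrapT => none.
pose tri (F : E -> E -> E -> nat) :=
  \sum_(e in X) \sum_(f in X) \sum_(g in X) F e f g.
have triD F G : tri (fun e f g => F e f g + G e f g) = tri F + tri G.
  rewrite /tri -big_split; apply: eq_bigr => e _.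
  rewrite -big_split; apply: eq_bigr => f _; exact: big_split.
(* The three rotations of an event have the same count. *)
have tri_rot F : tri (fun e f g => F f g e) = tri F.
  rewrite /tri exchange_big; apply: eq_bigr => f _; exact: exchange_big.
have tri_bound (F : E -> E -> E -> bool) :
    (forall e f, e \in X -> f \in X -> 8 * #|[set g in X | F e f g]| <= #|X|) ->
    8 * tri F <= #|X| * (#|X| * #|X|).
  move=> hF; rewrite -!sum_nat_const big_distrr; apply: leq_sum => e eX.
  rewrite big_distrr; apply: leq_sum => f fX.
  by rewrite -card_setI_sum hF.
pose B (e f g : E) := b f g.
have hB : 8 * tri B <= #|X| * (#|X| * #|X|) by apply: tri_bound => e f eX; exact: hb.
have hH := tri_bound _ hh.
(* Without a good triple the six events cover all triples, although their counts add up to at most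
   6/8 of the total. *)
have : #|X| * (#|X| * #|X|) <=
    tri (fun e f g => (B e f g + B f g e + B g e f) + (h e f g + h f g e + h g e f)).
  rewrite -!sum_nat_const; apply: leq_sum => e eX; apply: leq_sum => f fX.
  rewrite -sum1_card; apply: leq_sum => g gX; rewrite lt0n; apply/negP => /eqP z.
  apply: none; exists e, f, g; split=> //; move: z; rewrite /B.
  by case: (b e f); case: (b f g); case: (b g e); case: (h e f g);
     case: (h f g e); case: (h g e f).
rewrite !triD (tri_rot (fun e f g => B e f g)) (tri_rot (fun e f g => B f g e)).
rewrite (tri_rot (fun e f g => B e f g)) (tri_rot (fun e f g => h e f g)).
rewrite (tri_rot (fun e f g => h f g e)) (tri_rot (fun e f g => h e f g)).
have : 0 < #|X| * (#|X| * #|X|) by rewrite !muln_gt0 X0.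
move: hB hH; move: (tri (fun e f g => B e f g)) (tri (fun e f g => h e f g)).
by move: (#|X| * _); clear; lia.
Qed.

End Congestion.

(** * Closing three walks into a tight cycle *)

Section Cycle.
Context {T : finType} (H : {set {set T}}) {m : nat}.
Implicit Types (e x y : m.+1.-tuple T).

(** After a multiple of [m.+1] steps the walk ends in [x] unrotated, and [0 < k] puts [x] entirely
    inside [s]. The forbidden set is dropped, since only the loads matter from here on. *)
Definition linked (l : nat) e x (s : seq T) : Prop :=
  exists k, [/\ 0 < k, k * m.+1 <= l & tight_walk H e set0 (k * m.+1) x s].

Lemma linked_size l e x s : linked l e x s -> size s <= l.
Proof. by case=> k [_ kl [-> _ _ _ _]]. Qed.

Lemma linkedP l e x s : linked l e x s ->
  [/\ uniq s, windows_in H m.+1 (e ++ s) & exists p, s = p ++ x].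
Proof.
case=> k [k0 _ [ss us _ ws [p sE]]]; split=> //.
  by move: us; rewrite cat_uniq => /and3P[].
have sp : size p = size s.
  have := congr1 size sE; rewrite !size_cat !size_tuple addnC => /eqP.
  by rewrite eqn_add2r => /eqP.
exists (drop m.+1 p); rewrite -(drop_size_cat s (size_tuple e)) sE iter_turn_period.
rewrite drop_cat; case: (ltnP m.+1 (size p)) => // h.
have E : size p = m.+1 by apply/eqP; rewrite eqn_leq h sp ss leq_pmull.
by rewrite E subnn drop0 drop_oversize ?E.
Qed.

(** [e ++ s1 ++ s2 ++ s3] is glued along the overlaps [f] and [g]; as [s3] ends with [e], the part
    after the initial [e] closes up. *)
Lemma linked_triangle_cycle l e f g s1 s2 s3 :
  linked l e f s1 -> linked l f g s2 -> linked l g e s3 ->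
  ~~ has (mem s1) s2 -> ~~ has (mem s2) s3 -> ~~ has (mem s3) s1 ->
  tight_cycle m.+1 H (s1 ++ s2 ++ s3).
Proof.
move=> /linkedP[u1 w1 [p1 E1]] /linkedP[u2 w2 [p2 E2]] /linkedP[u3 w3 [p3 E3]].
move=> d12 d23 d31; apply: (@tight_cycle_of_windows _ _ _ e).
- rewrite !cat_uniq u1 u2 u3 has_cat negb_or d12 d23 !andbT /=.
  by rewrite has_sym.
- rewrite E1 E2 !size_cat !size_tuple !addnS !addSn !ltnS.
  by rewrite -!addnA addnCA leq_addr.
- exact: size_tuple.
- rewrite E1 E2 -!catA catA; apply: windows_in_cat; rewrite ?size_tuple //.
    by rewrite -catA -E1.
  rewrite catA; apply: windows_in_cat; rewrite ?size_tuple //.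
  by rewrite -catA -E2.
by exists (s1 ++ s2 ++ p3); rewrite E3 !catA.
Qed.

Lemma robust_expander_cycle (X : {set m.+1.-tuple T}) (K M L : nat) :
  0 < M -> X != set0 -> #|X| < 2 ^ L -> robust_expander H X K M ->
  (let l := walk_length m M L in
   16 * m.+1 ^ 2 * M * (16 * l ^ 2 + m.+1 + l) <= K) ->
  exists c, tight_cycle m.+1 H c.
Proof.
move=> M0 Xn XL expX; set l := walk_length m M L => /= lK.
have L0 : 0 < L.
  by case: L XL @l lK => // /[!ltnS] /[!leqn0] /[!cards_eq0]; rewrite (negbTE Xn).
have l0 : 0 < l by rewrite !muln_gt0 M0.
have Xl : 16 * l <= #|X|.
  have /set0Pn[x xX] := Xn; have [_ deg _] := expX.
  apply: leq_trans (_ : K <= _).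
    apply: leq_trans lK; rewrite -2!mulnA leq_mul2l [m.+1 ^ 2 * _]mulnA.
    rewrite -[X in X <= _]mul1n; apply: leq_mul; last exact: leq_addl.
    by rewrite muln_gt0 expn_gt0 M0.
  apply: leq_trans (deg 0 _ xX) _; apply/subset_leq_card/subsetP => y.
  by rewrite inE => /andP[].
have paths e : exists Dp : {set m.+1.-tuple T} * (m.+1.-tuple T -> seq T),
    e \in X ->
    [/\ Dp.1 \subset X, 8 * #|X :\: Dp.1| <= #|X|,
      forall x, x \in Dp.1 -> linked l e x (Dp.2 x)
      & forall u, 8 * l * load Dp.1 Dp.2 u <= #|X|].
  have [eX|eX] := boolP (e \in X); last by exists (set0, fun=> [::]).
  have [//|//|x s||D [p ?]] := @low_congestion _ T X (linked l e) l; last by exists (D, p).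
    exact: linked_size.
  move=> W Wc; have := @reached_most _ H _ X K M L e W M0 XL expX _ eX.
  case.
    apply: leq_trans lK; rewrite leq_mul2l; apply/orP; right.
    by rewrite !leq_add2r.
  move=> k kl big; exists (reached H X e W (k * m.+1)); split=> //.
    by apply/subsetP => x /reachedP[].
  move=> x /reachedP[xX [s [ss us sW ws sE]]]; exists s => //; exists k; split=> //.
  (* Zero steps reach at most [e] itself, which is not most of [X] because [16 * l <= #|X|]. *)
  - rewrite lt0n; apply: contraL big => /eqP ->; rewrite -leqNgt.
    have R1 : reached H X e W (0 * m.+1) \subset [set e].
      apply/subsetP => y /reachedP[_ [s' [/size0nil -> _ _ _ [p E]]]].
      rewrite cats0 in E; have := congr1 size E.
      rewrite size_cat !size_tuple -[X in X = _]add0n.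
      move=> /eqP; rewrite eqn_add2r => /eqP/esym/size0nil p0; move: E.
      by rewrite p0 iter_turn_period => /val_inj ->; rewrite inE.
    apply: leq_trans (leq_mul (leqnn 16) (subset_leq_card R1)) _.
    rewrite cards1; apply: leq_trans (leq_trans _ Xl) (leq_pmull _ _) => //.
    by rewrite leq_mul2l l0.
  - by split=> // u _; rewrite inE.
have [Dp {}paths] := choice paths.
pose D e := (Dp e).1; pose p e := (Dp e).2.
(* The bad events: no walk from [e] to [f] was chosen, or the walks [e -> f] and [f -> g] meet. The
   rotations of the latter cover all pairs among the three walks. *)
have [||e [f [g [[eX fX gX] /and5P[ef fg ge hefg /andP[hfge hgef]]]]]] :=
    @good_triple _ X (fun e f => f \notin D e)
      (fun e f g => [&& f \in D e, g \in D f & has (mem (p e f)) (p f g)]) Xn.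
- move=> e eX; have [_ h _ _] := paths _ eX; apply: leq_trans h.
  rewrite leq_mul2l; apply/orP; right; apply/subset_leq_card/subsetP => f.
  by rewrite !inE andbC.
- move=> e f eX fX; have [fD|fD] := boolP (f \in D e); last first.
    by rewrite (_ : [set g in X | _] = set0) ?cards0 //; apply/setP => g; rewrite !inE andbF.
  have [_ _ linke _] := paths _ eX; have [_ _ _ loadf] := paths _ fX.
  rewrite -(leq_pmul2l l0) mulnA [l * 8]mulnC.
  (* Union bound over the at most [l] vertices of [p e f], each on at most [#|X| / (8 * l)] of the
     walks from [f]. *)
  have sub : [set g in X | [&& true, g \in D f & has (mem (p e f)) (p f g)]] \subset
      \bigcup_(u in p e f) [set g in D f | u \in p f g].
    apply/subsetP => g; rewrite inE => /and4P[_ _ gD /hasP[u ug ue]].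
    by apply/bigcupP; exists u => //; rewrite inE gD.
  apply: leq_trans (leq_mul (leqnn _) (leq_trans (subset_leq_card sub) (card_bigcup_leq _ _))) _.
  rewrite big_distrr /=; apply: leq_trans (_ : \sum_(u in p e f) #|X| <= _).
    by apply: leq_sum => u _; exact: loadf.
  rewrite sum_nat_const leq_mul2r; apply/orP; right.
  by rewrite (leq_trans (card_size _)) // (linked_size (linke _ fD)).
move: ef fg ge hefg hfge hgef; rewrite !negbK => ef fg ge; rewrite ef fg ge /=.
move=> h1 h2 h3; exists (p e f ++ p f g ++ p g e).
have [_ _ linke _] := paths _ eX; have [_ _ linkf _] := paths _ fX.
have [_ _ linkg _] := paths _ gX.
exact: linked_triangle_cycle (linke _ ef) (linkf _ fg) (linkg _ ge) h1 h2 h3.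
Qed.

End Cycle.

Local Open Scope ring_scope.

(** * The density threshold *)

Section Entropy.
Context {R : realType}.

Lemma ln_nat_le (p q : nat) : (0 < p)%N -> (p <= q)%N -> ln p%:R <= ln q%:R :> R.
Proof.
by move=> p0 pq; rewrite ler_ln ?posrE ?ltr0n ?ler_nat // (leq_trans p0).
Qed.

Lemma ln2_gt0 : 0 < ln 2 :> R.
Proof. by apply: ln_gt0; rewrite ltr1n. Qed.

(** Since [x + y >= 2 * x], the term [x * log2 (x + y)] exceeds [x * log2 x] by at least [x]. *)
Lemma nlog2_superadditive (x y : nat) : (x <= y)%N ->
  x%:R * log2 x%:R + y%:R * log2 y%:R + x%:R <= (x + y)%:R * log2 (x + y)%:R :> R.
Proof.
move=> xy; case: (posnP x) => [->|x0]; first by rewrite !mul0r add0r addr0 add0n.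
rewrite /log2 -(ler_pM2r ln2_gt0) !mulrDl -!mulrA !mulVf ?gt_eqF ?ln2_gt0 //.
rewrite !mulr1 natrD mulrDl addrAC -mulrDr lerD //.
  rewrite ler_wpM2l // -lnM ?posrE ?ltr0n // -natrM -natrD ln_nat_le ?muln_gt0 ?x0 //.
  by rewrite muln2 -addnn leq_add2l.
by rewrite ler_wpM2l // -natrD ln_nat_le ?leq_addl // (leq_trans x0).
Qed.

Lemma log2_le_exp (p L : nat) : (p <= 2 ^ L)%N -> p%:R * log2 p%:R <= L%:R * p%:R :> R.
Proof.
case: (posnP p) => [->|p0 pL]; first by rewrite mul0r mulr0.
rewrite mulrC ler_wpM2r // /log2 ler_pdivrMr ?ln2_gt0 //.
rewrite (le_trans (ln_nat_le p0 pL)) // natrX lnXn ?ltr0n //.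
by rewrite mulr_natl.
Qed.

End Entropy.

(* The codegree needed by [reached_most] when [16 * l ^ 2] vertices are
   forbidden, [M] being the expansion constant of [expander_subset]. *)
Definition threshold (m L : nat) : nat :=
  let M := (16 * (1 + 2 * L))%N in let l := walk_length m M L in
  (16 * m.+1 ^ 2 * M * (16 * l ^ 2 + m.+1 + l))%N.

(** * From density to a tight cycle *)

Section Main.
Context {T : finType} (H : {set {set T}}) {m : nat}.

(** Thanks to the tag, two tuples share the element tagged [i] exactly if they agree outside
    coordinate [i]. *)
Definition incident (x : m.+1.-tuple T) : {set 'I_m.+1 * m.-tuple T} :=
  [set (i, facet i x) | i : 'I_m.+1].

Lemma incidentP (i : 'I_m.+1) (x y : m.+1.-tuple T) :
  ((i, facet i x) \in incident y) = (facet i y == facet i x).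
Proof.
apply/imsetP/eqP => [[j _ E]|E]; last by exists i; rewrite // E.
have ij : i = j := congr1 fst E; have := congr1 snd E.
by rewrite [LHS](_ : _ = facet i x) // => ->; rewrite ij.
Qed.

Lemma boundary_sub_star (X F : {set m.+1.-tuple T}) :
  boundary incident X F \subset \bigcup_(j < m.+1) star X (facet j) F :\: F.
Proof.
apply/subsetP => y; rewrite !inE => /andP[/andP[-> yX]] /=.
rewrite -setI_eq0 => /set0Pn[s /setIP[/imsetP[i _ ->] /shadowP[x xF]]].
rewrite incidentP => /eqP E; apply/bigcupP; exists i => //.
by rewrite inE yX -E imset_f.
Qed.

Lemma dense_tight_cycle (R : realType) (L : nat) :
  uniform_hypergraph m.+1 H -> (0 < #|H|)%N ->
  (#|T| ^ m.+1 < 2 ^ L)%N -> (m.+1 * #|T| ^ m <= 2 ^ L)%N ->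
  (2 * threshold m L * (m.+1 * #|T| ^ m) <= #|H|)%N ->
  exists c, tight_cycle m.+1 H c.
Proof.
move=> unif H0 nL sL dense; set K := threshold m L in dense.
have e0 : exists e, e \in H by apply/card_gt0P.
have T0 : (0 < #|T|)%N.
  have [e eH] := e0; apply: leq_trans (max_card (mem e)).
  by have /forall_inP/(_ _ eH)/eqP -> := unif.
have L0 : (0 < L)%N.
  rewrite lt0n; apply: contraTneq nL => ->.
  by rewrite expn0 ltnS leqn0 expn_eq0 andbT eqn0Ngt T0.
(* All orderings of edges: at least [#|H|] tuples, whose shadow has at most [m.+1 * #|T| ^ m]
   elements. *)
pose X0 := [set x : m.+1.-tuple T | uniq x & [set z in x] \in H].
have HX0 : (#|H| <= #|X0|)%N.
  apply: leq_trans (leq_imset_card (fun x : m.+1.-tuple T => [set z in x]) X0).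
  apply/subset_leq_card/subsetP => e eH.
  have se : size (enum e) == m.+1 by rewrite -cardE; exact: (forall_inP unif).
  have E : e = [set z in Tuple se] by apply/setP => z; rewrite inE mem_enum.
  by apply/imsetP; exists (Tuple se); rewrite // inE -E eH enum_uniq.
have X0n : X0 != set0 by rewrite -card_gt0 (leq_trans H0).
have shc : (#|shadow incident X0| <= m.+1 * #|T| ^ m)%N.
  by apply: leq_trans (max_card _) _; rewrite card_prod card_ord card_tuple.
have M0 : (0 < 16 * (1 + 2 * L))%N by [].
have l0 : (0 < walk_length m (16 * (1 + 2 * L)) L)%N by rewrite !muln_gt0 L0.
have K0 : (0 < K)%N.
  by rewrite /K /threshold muln_gt0 addn_gt0 l0 orbT andbT !muln_gt0.
have [] := @expander_subset _ _ incident R (fun p => p%:R * log2 p%:R) K%:R L%:R X0.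
- by rewrite ltr0n.
- by rewrite ler1n.
- by rewrite mul0r.
- by rewrite mul1r /log2 ln1 mul0r.
- exact: nlog2_superadditive.
- by move=> p pX; apply/log2_le_exp/(leq_trans pX)/(leq_trans shc).
- exact: X0n.
- rewrite -!natrM ler_nat (leq_trans _ HX0) // (leq_trans _ dense) //.
  by rewrite leq_mul2l shc orbT.
move=> X [XX0 Xn deg expX].
apply: (@robust_expander_cycle _ H m X K (16 * (1 + 2 * L)) L M0 Xn) => //.
  apply: leq_ltn_trans nL; rewrite -card_tuple; exact: max_card.
split.
- by move=> x /(subsetP XX0); rewrite inE => /andP[].
(* Facets are periodic in [t], so the shadow degrees at the [m.+1] coordinates cover every [t]. *)
- move=> t x xX; have im : (t %% m.+1 < m.+1)%N by rewrite ltn_pmod.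
  have fE (y : m.+1.-tuple T) : facet t y = facet (Ordinal im) y.
    by rewrite -[RHS](facet_period (t %/ m.+1)%N) -divn_eq.
  have := deg (Ordinal im, facet (Ordinal im) x).
  rewrite ler_nat => /(_ _)/leq_trans; apply.
    by apply/shadowP; exists x => //; rewrite incidentP.
  apply/subset_leq_card/subsetP => y.
  by rewrite !inE incidentP !fE.
move=> F FX Fc; have := expX _ FX Fc.
rewrite -natrM -(natrD _ 1) -!natrM ler_nat => /leq_trans; apply.
by rewrite leq_mul2l subset_leq_card ?orbT // boundary_sub_star.
Qed.

End Main.

(** * The bound for hypergraphs without tight cycles *)

Lemma threshold_le (m L : nat) : (0 < L)%N ->
  (threshold m L <= threshold m 1 * L ^ 5)%N.
Proof.
move=> L0; rewrite /threshold.
(* [M] grows like [L] and the walk length [l] like [M * L], so the threshold, of order [M * l ^ 2],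
   grows like [L ^ 5]. *)
have hM : (16 * (1 + 2 * L) <= 16 * (1 + 2 * 1) * L)%N by nia.
set M := (16 * (1 + 2 * L))%N in hM *; set M1 := (16 * _)%N in hM *.
have hl : (walk_length m M L <= walk_length m M1 1 * L ^ 2)%N.
  rewrite /walk_length muln1.
  apply: leq_trans (_ : m.+1 * (2 * (m.+1 * (M1 * L)) * L) <= _)%N.
    by rewrite leq_mul2l leq_mul2r leq_mul2l leq_mul2l hM !orbT.
  by apply: eq_leq; ring.
set l := walk_length _ _ _ in hl *; set l1 := walk_length _ _ _ in hl *.
have L4 : (0 < L ^ 4)%N by rewrite expn_gt0 L0.
have hs : (16 * l ^ 2 + m.+1 + l <= (16 * l1 ^ 2 + m.+1 + l1) * L ^ 4)%N.
  have -> : ((16 * l1 ^ 2 + m.+1 + l1) * L ^ 4 =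
      16 * (l1 * L ^ 2) ^ 2 + m.+1 * L ^ 4 + l1 * L ^ 4)%N by ring.
  apply: leq_add; [apply: leq_add|].
  - by rewrite leq_mul2l leq_exp2r.
  - by rewrite leq_pmulr.
  by rewrite (leq_trans hl) // leq_mul2l leq_pexp2l ?orbT.
apply: leq_trans (leq_mul (leq_mul (leqnn _) hM) hs) _.
by apply: eq_leq; ring.
Qed.

Lemma tight_cycle_free_bound (R : realType) (m : nat) :
  exists2 C : R, 0 <= C & forall (T : finType) (H : {set {set T}}),
    (2 <= #|T|)%N -> uniform_hypergraph m.+1 H -> tight_cycle_free m.+1 H ->
    #|H|%:R <= C * #|T|%:R ^+ m * log2 #|T|%:R ^+ 5.
Proof.
(* [c] collects the constants of the density condition; the other factor comes from
   [L <= (3 * m.+1) * log2 n], where [t + 2 <= 3 * log2 n] because [1 <= log2 n]. *)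
pose c := (2 * threshold m 1 * m.+1)%N.
exists (c%:R * (3 * m.+1)%:R ^+ 5) => [|T H n2 unif free].
  by rewrite mulr_ge0 // exprn_ge0.
rewrite leNgt; apply/negP => dense.
set n := #|T| in n2 dense; set N : R := log2 n%:R in dense.
(* As [n < 2 ^ t.+1], an exponent [m.+1 * t.+1] suffices for [n ^ m.+1]; the extra [m.+1] absorbs
   the factor [m.+1] of the shadow bound. *)
pose t := trunc_log 2 n; pose L := (m.+1 * t.+2)%N.
have n0 : (0 < n)%N by apply: ltnW.
have ln20 : 0 < ln 2 :> R := ln2_gt0.
have N1 : 1 <= N by rewrite /N /log2 ler_pdivlMr // mul1r ln_nat_le.
have tN : t%:R <= N.
  rewrite /N /log2 ler_pdivlMr // mulr_natl -lnXn // -natrX ln_nat_le ?expn_gt0 //.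
  exact: trunc_logP.
have LN : L%:R <= (3 * m.+1)%:R * N.
  rewrite /L !natrM mulrAC [leRHS]mulrC ler_wpM2l //.
  by rewrite -[t.+2]addn2 natrD; lra.
have nt : (n < 2 ^ t.+1)%N := trunc_log_ltn n (isT : (1 < 2)%N).
have nL : (n ^ m.+1 < 2 ^ L)%N.
  apply: (@leq_trans ((2 ^ t.+1) ^ m.+1)); first by rewrite ltn_exp2r.
  by rewrite -expnM leq_exp2l // mulnC leq_mul2l leqnSn orbT.
have sL : (m.+1 * n ^ m <= 2 ^ L)%N.
  apply: (@leq_trans (2 ^ m.+1 * (2 ^ t.+1) ^ m)).
    apply: leq_mul; first exact/ltnW/ltn_expl.
    by case: (m) => // k; rewrite leq_exp2r // ltnW.
  by rewrite -expnM -expnD leq_exp2l // /L mulnS leq_add2l mulnC leq_mul2r leqnSn orbT.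
have L0 : (0 < L)%N by rewrite muln_gt0.
have main : (2 * threshold m L * (m.+1 * n ^ m) <= #|H|)%N.
  rewrite -(ler_nat R); apply: le_trans (ltW dense).
  apply: (@le_trans _ _ (c%:R * L%:R ^+ 5 * n%:R ^+ m)).
    rewrite -!natrX -!natrM ler_nat /c.
    apply: (@leq_trans (2 * (threshold m 1 * L ^ 5) * (m.+1 * n ^ m))).
      by rewrite leq_mul2r leq_mul2l threshold_le // !orbT.
    by apply: eq_leq; ring.
  rewrite [leRHS](_ : _ = c%:R * ((3 * m.+1)%:R * N) ^+ 5 * n%:R ^+ m); last first.
    by move: (3 * m.+1)%:R c%:R (n%:R ^+ m) (N) => a x y z; ring.
  rewrite ler_wpM2r ?exprn_ge0 // ler_wpM2l //.
  by rewrite lerXn2r // nnegrE // (le_trans _ LN).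
have H0 : (0 < #|H|)%N.
  rewrite -(ltr_nat R); apply: le_lt_trans dense.
  apply: mulr_ge0; last by rewrite exprn_ge0 // (le_trans ler01).
  by apply: mulr_ge0; [apply: mulr_ge0 => //|]; rewrite exprn_ge0.
have [s sc] := dense_tight_cycle R unif H0 nL sL main.
by have := free s; rewrite sc.
Qed.

(* The uniform and the asymptotic form *)
From mathcomp Require Import all_classical all_reals all_analysis.
Import numFieldNormedType.Exports.

Local Open Scope classical_set_scope.
Local Open Scope ring_scope.

Theorem theorem1p1 (R : realType) (r : nat) (hr : (2 <= r)%N) :
  (exists C : R,
     forall (T : finType) (H : {set {set T}}),
       (2 <= #|T|)%N ->
       uniform_hypergraph r H ->
       tight_cycle_free r H ->
       #|H|%:R <= C * #|T|%:R ^+ (r - 1) * log2 #|T|%:R ^+ 5)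
  /\
  (fun n : nat => (ex_tight r n)%:R : R^o)
    =O_\oo (fun n : nat => n%:R ^+ (r - 1) * log2 n%:R ^+ 5 : R^o).
Proof.
case: r hr => // m _; rewrite subn1 /=.
have [C C0 bound] := tight_cycle_free_bound R m.
split; first by exists C => T H; exact: bound.
(* [C] may be 0, whereas the constant of the asymptotic bound has to be positive. *)
apply/eqO_exP; exists (C + 1); first by rewrite ltr_wpDl.
near=> n.
have n2 : (2 <= n)%N by near: n; exact: nbhs_infty_ge.
have log0 : 0 <= log2 n%:R :> R.
  by rewrite divr_ge0 // ln_ge0 // ler1n // ltnW.
have e0 : 0 <= n%:R ^+ m * log2 n%:R ^+ 5 :> R by rewrite mulr_ge0 ?exprn_ge0.
rewrite ger0_norm // ger0_norm //.
apply: (@le_trans _ _ (C * (n%:R ^+ m * log2 n%:R ^+ 5))); last first.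
  by rewrite ler_wpM2r // lerDl.
(* The bound passes to the maximum: it holds for each hypergraph and for the default value 0. *)
rewrite /ex_tight; elim/big_ind: _ => [|x y hx hy|H /andP[unif /asboolP free]].
- by rewrite mulr_ge0.
- by rewrite /maxn; case: ifP.
by have := bound 'I_n H; rewrite card_ord mulrA; exact.
Unshelve. all: by end_near.
Qed.
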